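(* Let $\mathbb{F}$ be a field of characteristic $0$, let $\mathbb{V}$ be an $n$-dimensional vector space over $\mathbb{F}$ with a basis $b_1,\dots,b_n$, and let $(\cdot,\cdot)$ be the symmetric bilinear form on $\mathbb{V}$ with $(b_i,b_j)=\delta_{ij}$. Let $\mathbb{A}$ be the ternary algebra on $\mathbb{V}$ with product $[x,y,z]=(y,z)x+(x,z)y+(x,y)z$. Then $$\mathrm{Der}(\mathbb{A})=\mathrm{Inder}(\mathbb{A})=so(n).$$
   Context: $\mathrm{Der}(\mathbb{A})$ is the Lie algebra of all linear maps $D:\mathbb{V}\to\mathbb{V}$ with $D[x,y,z]=[D(x),y,z]+[x,D(y),z]+[x,y,D(z)]$ for all $x,y,z\in\mathbb{V}$. For $x=(x_1,x_2)$, $y=(y_1,y_2)$ with $x_i,y_i\in\mathbb{V}$, put $D_{x,y}(z)=[[z,x_1,x_2],y_1,y_2]-[[z,y_1,y_2],x_1,x_2]$. The algebra of inner derivations $\mathrm{Inder}(\mathbb{A})$ is the $\mathbb{F}$-linear span of all the operators $D_{x,y}$. Here $so(n)$ denotes the Lie algebra of all linear operators on $\mathbb{V}$ that are skew-symmetric with respect to $(\cdot,\cdot)$, i.e. whose matrix in the basis $b_1,\dots,b_n$ is a skew-symmetric $n\times n$ matrix over $\mathbb{F}$. *)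

(* Defs.v *)
From HB Require Import structures.
From mathcomp Require Import all_boot all_order all_algebra.
From mathcomp Require Import classical_sets.

Set Implicit Arguments.
Unset Strict Implicit.
Unset Printing Implicit Defensive.

Import GRing.Theory.
Local Open Scope classical_set_scope.
Local Open Scope ring_scope.

Definition linear_span (F : fieldType) (W : vectType F) (S : set W) : set W :=
  [set w | exists2 X : seq W, (forall v, v \in X -> S v) & w \in <<X>>%VS].

Section TernaryAlgebra.

Variables (F : fieldType) (V : vectType F) (prod3 : V -> V -> V -> V).

Definition Der : set 'End(V) :=
  [set D | forall x y z : V,
     D (prod3 x y z) = prod3 (D x) y z + prod3 x (D y) z + prod3 x y (D z)].

Definition inner_op (x y : V * V) (z : V) : V :=
  prod3 (prod3 z x.1 x.2) y.1 y.2 - prod3 (prod3 z y.1 y.2) x.1 x.2.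

(* [inner_op x y] is a bare function, hence the pointwise equality;
   it is linear as soon as [prod3] is linear in its first argument
   (see [inner_op_linear]). *)
Definition Inder : set 'End(V) :=
  linear_span [set D : 'End(V) | exists x y : V * V, D =1 inner_op x y].

Lemma inner_op_linear (x y : V * V) :
  (forall u v, linear (fun z => prod3 z u v)) -> linear (inner_op x y).
Proof.
move=> lin3 a u v; rewrite /inner_op.
by rewrite !(lin3 _ _ a) scalerBr opprD addrACA.
Qed.

End TernaryAlgebra.

Section SymmetricForm.

Variables (F : fieldType) (V : vectType F) (form : {symmetric V}).

Definition form_prod3 (x y z : V) : V :=
  form y z *: x + form x z *: y + form x y *: z.

Definition so : set 'End(V) :=
  [set D | forall x y : V, form (D x) y = - form x (D y)].

Lemma form_prod3_linearl (u v : V) : linear (fun z => form_prod3 z u v).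
Proof.
move=> a x y; rewrite /form_prod3 !linearPl /= !scalerDl !scalerDr !scalerA.
by rewrite (mulrC _ a) (addrACA _ _ _ (form y v *: u)) [LHS]addrACA.
Qed.

End SymmetricForm.

(* Main.v *)
From HB Require Import structures.
Require Import Defs.
From mathcomp Require Import all_boot all_order all_algebra.
From mathcomp Require Import classical_sets.
From mathcomp Require Import ring.

Import GRing.Theory.
Local Open Scope classical_set_scope.
Local Open Scope ring_scope.

(** Write [R u v] for the operator sending [z] to [form_prod3 form z u v], so
    that the inner derivations are spanned by the commutators of these
    operators. The theorem is the chain of inclusions
    Der <= so <= Inder <= so <= Der.

    - Der <= so ([Der_sub_so]). For a derivation D, the symmetric form
      g(x,y) = (D x, y) + (x, D y) measures how far D is from being skew, and
      the derivation identity reads g(y,z) x + g(x,z) y + g(x,y) z = 0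
      ([form_prod3_defect]). On the diagonal it says 3 g(x,x) x = 0, hence
      g(x,x) = 0, and g = 0 by polarization. This divides by 3 and by 2.

    - so <= Inder ([so_sub_Inder]). The commutator of [R a a] and [R a c] is
      2 (a,a) times the rotation generator z |-> (z,a) c - (z,c) a
      ([inner_op_wedge]). If D is skew, taking a = b_i and c = D b_i and summing
      over an orthonormal basis gives 4 D.

    - Inder <= so ([Inder_sub_so]). Every [R u v] is self-adjoint, and a
      commutator of self-adjoint operators is skew.

    - so <= Der ([so_sub_Der]). For a skew D the form g vanishes, and with it
      the defect of the derivation identity. *)

Section SymmetricForm.

Variables (F : fieldType) (V : vectType F) (form : {symmetric V}).

Lemma form_sym (x y : V) : form x y = form y x.
Proof. by rewrite hermC expr0 mul1r. Qed.

Lemma form_prod3_selfadjoint (u v z w : V) :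
  form (form_prod3 form z u v) w = form z (form_prod3 form w u v).
Proof.
rewrite /form_prod3 !linearDl !linearDr /= !linearZl_LR !linearZr_LR /=.
by rewrite (form_sym w u) (form_sym w v); ring.
Qed.

Lemma so_span_closed (X : seq 'End(V)) (D : 'End(V)) :
  (forall E, E \in X -> so form E) -> D \in <<X>>%VS -> so form D.
Proof.
move=> soX; rewrite -[X]in_tupleE => /coord_span -> x y.
rewrite !sum_lfunE linear_sumlz linear_sum -sumrN; apply: eq_bigr => i _.
rewrite !scale_lfunE /= linearZl_LR linearZr_LR /= soX ?mulrN //.
by rewrite mem_nth.
Qed.

Lemma Inder_sub_so : Inder (form_prod3 form) `<=` so form.
Proof.
move=> D [X innerX]; apply: so_span_closed => {}D /innerX[x [y defD]] u v.
rewrite !defD /inner_op linearBl linearBr /=.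
by rewrite !form_prod3_selfadjoint opprB.
Qed.

(** [D] passes freely through the vectors x, y, z on the right of each term of the
    product; what remains comes from differentiating the scalar coefficients,
    that is, from the change g of the form under [D]. *)
Lemma form_prod3_defect (D : 'End(V)) (x y z : V) :
  let g u v := form (D u) v + form u (D v) in
  form_prod3 form (D x) y z + form_prod3 form x (D y) z
    + form_prod3 form x y (D z)
  = D (form_prod3 form x y z) + (g y z *: x + g x z *: y + g x y *: z).
Proof.
rewrite /form_prod3 /= !linearD !linearZ /= !scalerDl.
by rewrite [LHS](AC (3*3*3) ((1*5*9)*((4*7)*(2*8)*(3*6)))).
Qed.

Lemma so_sub_Der : so form `<=` Der (form_prod3 form).
Proof.
move=> D soD x y z; rewrite form_prod3_defect.
by rewrite !soD !addNr !scale0r !addr0.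
Qed.

Lemma Der_sub_so :
  [pchar F] =i pred0 -> Der (form_prod3 form) `<=` so form.
Proof.
move=> /pcharf0P char0 D derD.
pose g x y := form (D x) y + form x (D y).
have g_sym x y : g x y = g y x.
  by rewrite /g addrC (form_sym x) (form_sym (D x)).
have g_diag x : g x x = 0.
  have [->|x_neq0] := eqVneq x 0; first by rewrite /g !linear0 addr0.
  have := derD x x x; rewrite form_prod3_defect -[LHS]addr0 -/(g x x).
  move/addrI/esym/eqP; rewrite -!mulr2n -mulrSr -scaler_nat scaler_eq0 char0 /=.
  by rewrite scaler_eq0 (negPf x_neq0) orbF => /eqP.
(* Polarization: expand g (x + y) (x + y) = 0. *)
have gD x y z : g (x + y) z = g x z + g y z.
  by rewrite /g !linearD !linearDl /=; ring.
move=> x y; apply/eqP; rewrite -addr_eq0; apply/eqP; rewrite -/(g x y).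
have := g_diag (x + y).
rewrite gD !(g_sym _ (x + y)) !gD !g_diag add0r addr0 (g_sym y) => /eqP.
by rewrite -mulr2n -mulr_natl mulf_eq0 char0 => /eqP.
Qed.

(** The part of the multiplication operator [form_prod3 form ^~ u v] that is left
    after removing the scalar operator [form u v]: in the identification of
    operators with tensors given by the form, it is the symmetric tensor
    u (x) v + v (x) u. *)
Definition sym_outer (u v z : V) : V := form z v *: u + form z u *: v.

Lemma sym_outer_linear (u v : V) : linear (sym_outer u v).
Proof.
move=> k z w; rewrite /sym_outer !linearDl /= !linearZl_LR /=.
by rewrite !scalerDl -!scalerA scalerDr addrACA.
Qed.

Lemma form_prod3E (z u v : V) :
  form_prod3 form z u v = form u v *: z + sym_outer u v z.
Proof. by rewrite /form_prod3 addrA. Qed.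

(** Scalar operators commute with everything, so only the parts [sym_outer]
    survive in the commutator. *)
Lemma inner_op_commutator (u v u' v' z : V) :
  inner_op (form_prod3 form) (u, v) (u', v') z =
  sym_outer u' v' (sym_outer u v z)
    - sym_outer u v (sym_outer u' v' z).
Proof.
rewrite /inner_op /= !form_prod3E !sym_outer_linear !scalerDr !scalerA.
rewrite (mulrC (form u' v')) [X in _ - X](AC (2*2) ((1*3)*2*4)) /=.
by rewrite [X in X - _]addrA opprD addrACA subrr add0r.
Qed.

(** Both products of [sym_outer a a] and [sym_outer a c] contain the symmetric
    term 2 (a,c) (z,a) a, which cancels. What is left is the generator of the
    rotations in the plane of [a] and [c]; these generators span so. *)
Lemma inner_op_wedge (a c z : V) :
  inner_op (form_prod3 form) (a, a) (a, c) z =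
  (2%:R * form a a) *: (form z a *: c - form z c *: a).
Proof.
rewrite inner_op_commutator /sym_outer !linearDl /= !linearZl_LR /=.
rewrite (form_sym c) -!scalerDl addrAC -scalerBl addrC scalerBr !scalerA -scaleNr.
by congr (_ *: _ + _ *: _); ring.
Qed.

Definition inner_lfun (x y : V * V) : 'End(V) :=
  linfun (inner_op (form_prod3 form) x y).

Lemma inner_lfunE (x y : V * V) :
  inner_lfun x y =1 inner_op (form_prod3 form) x y.
Proof.
pose lin := inner_op_linear x y (form_prod3_linearl form).
pose f : {linear V -> V} := HB.pack (inner_op (form_prod3 form) x y)
  (GRing.isLinear.Build F V V *:%R _ lin).
exact: (lfunE f).
Qed.

Lemma orthonormal_expansion (n : nat) (b : n.-tuple V) (z : V) :
  basis_of fullv b ->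
  (forall i j : 'I_n, form (tnth b i) (tnth b j) = (i == j)%:R) ->
  z = \sum_i form z (tnth b i) *: tnth b i.
Proof.
move=> b_basis b_orthonormal; have def_z := coord_basis b_basis (memvf z).
rewrite {1}def_z; apply: eq_bigr => i _; rewrite (tnth_nth 0).
congr (_ *: _); rewrite [in RHS]def_z linear_sumlz (bigD1 i) //=.
rewrite big1 => [|j ji].
  by rewrite linearZl_LR /= -tnth_nth b_orthonormal eqxx mulr1 addr0.
by rewrite linearZl_LR /= -!tnth_nth b_orthonormal (negPf ji) mulr0.
Qed.

(** The terms 2 (z,b_i) D b_i of the commutators [W i] add up to 2 D z. The
    other terms, -2 (z, D b_i) b_i, are 2 (D z, b_i) b_i by skewness and add up
    to 2 D z as well; hence D is a quarter of the sum of the [W i]. *)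
Lemma so_sub_Inder (n : nat) (b : n.-tuple V) :
  [pchar F] =i pred0 ->
  basis_of fullv b ->
  (forall i j : 'I_n, form (tnth b i) (tnth b j) = (i == j)%:R) ->
  so form `<=` Inder (form_prod3 form).
Proof.
move=> /pcharf0P char0 b_basis b_orthonormal D soD.
have expand := orthonormal_expansion _ _ _ b_basis b_orthonormal.
pose W i := inner_lfun (tnth b i, tnth b i) (tnth b i, D (tnth b i)).
exists [seq W i | i : 'I_n].
  move=> _ /mapP[i _ ->].
  exists (tnth b i, tnth b i), (tnth b i, D (tnth b i)).
  exact: inner_lfunE.
suff -> : D = 4%:R^-1 *: \sum_i W i.
  by rewrite memvZ // memv_suml // => i _; rewrite memv_span ?fintype.image_f.
apply/lfunP => z; rewrite scale_lfunE sum_lfunE.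
have W_wedge i : W i z =
    2%:R *: (form z (tnth b i) *: D (tnth b i)
             + form (D z) (tnth b i) *: tnth b i).
  by rewrite inner_lfunE inner_op_wedge b_orthonormal eqxx mulr1 soD scaleNr.
rewrite (eq_bigr _ (fun i _ => W_wedge i)) -scaler_sumr big_split /=.
rewrite -expand.
have -> : \sum_i form z (tnth b i) *: D (tnth b i) = D z.
  rewrite {2}(expand z) linear_sum.
  by apply: eq_bigr => i _; rewrite linearZ.
rewrite -mulr2n -scaler_nat !scalerA -natrM mulVf ?scale1r //.
by rewrite char0.
Qed.

End SymmetricForm.

Theorem theorem11 (F : fieldType) (n : nat) (V : vectType F)
    (b : n.-tuple V) (form : {symmetric V}) :
  [pchar F] =i pred0 ->
  basis_of fullv b ->
  (forall i j : 'I_n, form (tnth b i) (tnth b j) = (i == j)%:R) ->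
  Der (form_prod3 form) = Inder (form_prod3 form) /\
  Inder (form_prod3 form) = so form.
Proof.
move=> char0 b_basis b_orthonormal.
have Inder_so : Inder (form_prod3 form) = so form.
  rewrite eqEsubset; split; first exact: Inder_sub_so.
  exact: so_sub_Inder char0 b_basis b_orthonormal.
split=> //; rewrite Inder_so eqEsubset.
by split; [apply: Der_sub_so | apply: so_sub_Der].
Qed.
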